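(* Let $n\ge 3$, $X=\{1,\dots,n\}$, let $p^*$ be a probability measure on the power set of $X$, and let $p$ be a probability measure on the power set of $X$ with $p(i)>0$ for all $i\in X$. Let $f_1,f_2\colon X\to\mathbb{R}$, put $d=f_1-f_2$, assume that $d$ is not strictly positive at every point of $X$, and assume that $\mathbb{E}_{p^*}[d]>0$. Suppose that $$\mathbb{E}_{q_\Pi}[d]\le 0\quad\text{for all }\Pi\in\mathfrak{P}.$$ Then $\mathbb{E}_p[d]<0$.
   Context: For a probability measure $q$ on the power set of $X=\{1,\dots,n\}$ write $q(i)=q(\{i\})$, and for $f\colon X\to\mathbb{R}$ write $\mathbb{E}_q[f]=\sum_{i=1}^n f(i)q(i)$. A partition $\Pi=\{B_1,\dots,B_m\}$ of $X$ into nonempty pairwise disjoint blocks with union $X$ is called proper non-trivial if $2\le m\le n-1$. $\mathfrak{P}$ denotes the set of all proper non-trivial partitions of $X$. For a partition $\Pi$ of $X$, the Jeffrey posterior $q_\Pi$ of $p$ determined by $\Pi$ (and $p^*$) is the probability measure on $X$ given by $q_\Pi(i)=p^*(B)\,\dfrac{p(i)}{p(B)}$ for $i\in B\in\Pi$. *)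

(* Defs.v *)
From HB Require Import structures.
From mathcomp Require Import all_boot all_order all_algebra.
From mathcomp Require Import all_classical all_reals all_analysis.

Set Implicit Arguments.
Unset Strict Implicit.
Unset Printing Implicit Defensive.

Import Order.TTheory GRing.Theory Num.Theory.

Local Open Scope classical_set_scope.
Local Open Scope ring_scope.

(* The set X of cardinality n.+1 is 'I_n.+1 (a measurableType has to be
   nonempty), equipped with its power set as sigma-algebra: hence
   [probability 'I_n.+1 R] is the type of probability measures on the power
   set of X. *)
HB.instance Definition _ (n : nat) := isPointed.Build 'I_n.+1 ord0.
HB.instance Definition _ (n : nat) :=
  @isMeasurable.Build default_measure_display 'I_n.+1 discrete_measurable
    discrete_measurable0 discrete_measurableC discrete_measurableU.

(* Measures take values in \bar R; [fine] is used only on finite values. *)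
Definition pt_mass (R : realType) (n : nat) (q : set 'I_n.+1 -> \bar R)
  (i : 'I_n.+1) : R := fine (q [set i]).

Definition block_mass (R : realType) (n : nat) (q : set 'I_n.+1 -> \bar R)
  (B : {set 'I_n.+1}) : R := fine (q [set` B]).

Definition expect (R : realType) (n : nat) (q : set 'I_n.+1 -> \bar R)
  (f : 'I_n.+1 -> R) : R := \sum_(i < n.+1) f i * pt_mass q i.

(* Here #|X| = n.+1, so that #|P| <= n.+1 - 1. *)
Definition proper_nontrivial (n : nat) (P : {set {set 'I_n.+1}}) : bool :=
  finset.partition P (finset.setTfor 'I_n.+1) && (2 <= #|P| <= n.+1 - 1)%N.

(* [finset.pblock P i] is the block B of P containing i. *)
Definition jeffrey_pmf (R : realType) (n : nat) (P : {set {set 'I_n.+1}})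
    (pstar p : probability 'I_n.+1 R) (i : 'I_n.+1) : R :=
  let B := finset.pblock P i in
  block_mass pstar B * (pt_mass p i / block_mass p B).

Definition jeffrey (R : realType) (n : nat) (P : {set {set 'I_n.+1}})
    (pstar p : probability 'I_n.+1 R) : set 'I_n.+1 -> \bar R :=
  fun A => (\sum_(i \in A) (jeffrey_pmf P pstar p i)%:E)%E.

Section jeffrey_measure.
Context (R : realType) (n : nat) (P : {set {set 'I_n.+1}}).
Context (pstar p : probability 'I_n.+1 R).

Lemma jeffrey_pmf_ge0 i : 0 <= jeffrey_pmf P pstar p i.
Proof.
by rewrite /jeffrey_pmf mulr_ge0 ?divr_ge0 // fine_ge0 // measure_ge0.
Qed.

Let jeffrey0 : jeffrey P pstar p set0 = 0%E.
Proof. by rewrite /jeffrey fsbig_set0. Qed.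

Let jeffrey_ge0 A : (0 <= jeffrey P pstar p A)%E.
Proof.
rewrite /jeffrey fsbig_finite//= sumEFin lee_fin.
by apply: sumr_ge0 => /= i _; exact: jeffrey_pmf_ge0.
Qed.

Let jeffrey_sigma_additive : semi_sigma_additive (jeffrey P pstar p).
Proof.
move=> F mF tF mUF; rewrite /jeffrey.
apply: cvg_toP.
  apply: ereal_nondecreasing_is_cvgn => k m km.
  apply: lee_sum_nneg_natr => // l _ _; exact: jeffrey_ge0.
transitivity (\sum_(0 <= k <oo)
    (\esum_(i in F k) (jeffrey_pmf P pstar p i)%:E))%E.
  apply: eq_eseriesr => k _; rewrite esum_fset//= => i _.
  by rewrite lee_fin jeffrey_pmf_ge0.
rewrite -nneseries_sum_bigcup//=; last first.
  by move=> i; rewrite lee_fin jeffrey_pmf_ge0.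
by rewrite esum_fset//= => i _; rewrite lee_fin jeffrey_pmf_ge0.
Qed.

HB.instance Definition _ := isMeasure.Build _ _ _ (jeffrey P pstar p)
  jeffrey0 jeffrey_ge0 jeffrey_sigma_additive.

Lemma pt_mass_jeffrey i : pt_mass (jeffrey P pstar p) i = jeffrey_pmf P pstar p i.
Proof. by rewrite /pt_mass /jeffrey fsbig_set1. Qed.

End jeffrey_measure.

Lemma block_massE (R : realType) (n : nat) (q : probability 'I_n.+1 R)
  (B : {set 'I_n.+1}) : block_mass q B = \sum_(i in B) pt_mass q i.
Proof.
rewrite /block_mass /pt_mass.
have -> : [set` B] = \bigcup_(i in [set` B]) [set i].
  by rewrite bigcup_imset1 image_id.
rewrite measure_fin_bigcup //; last by move=> i j _ _ [k [/= -> ->]].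
rewrite -(@bigfs _ _ _ _ (index_enum _) (mem B)) ?index_enum_uniq //; last first.
  by move=> i _; rewrite mem_index_enum.
rewrite (eq_bigr (fun i => (fine (q [set i]))%:E)); first by rewrite sumEFin.
by move=> i _; rewrite fineK // fin_num_measure.
Qed.

Lemma sum_pt_mass (R : realType) (n : nat) (q : probability 'I_n.+1 R) :
  \sum_(i < n.+1) pt_mass q i = 1.
Proof.
have := block_massE q (finset.setTfor 'I_n.+1).
rewrite /block_mass (_ : [set` _] = setT) ?probability_setT /=; last first.
  by apply/seteqP; split => // i _ /=; rewrite finset.in_setT.
by move=> ->; apply: eq_bigl => i; rewrite finset.in_setT.
Qed.

Lemma jeffrey_setT (R : realType) (n : nat) (P : {set {set 'I_n.+1}})
    (pstar p : probability 'I_n.+1 R) :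
  finset.partition P (finset.setTfor 'I_n.+1) ->
  (forall i, 0 < pt_mass p i) ->
  jeffrey P pstar p setT = 1%E.
Proof.
move=> PP p0; case/and3P: (PP) => _ tP nP; rewrite /jeffrey.
have -> : [set: 'I_n.+1] = [set` mem (finset.setTfor 'I_n.+1)].
  by apply/seteqP; split => // i _ /=; rewrite finset.in_setT.
rewrite -(@bigfs _ _ _ _ (index_enum _)) ?index_enum_uniq //; last first.
  by move=> i _; rewrite mem_index_enum.
rewrite sumEFin; congr (_%:E).
rewrite -(sum_pt_mass pstar).
have -> (F : 'I_n.+1 -> R) :
    \sum_(i < n.+1) F i = \sum_(i in finset.setTfor 'I_n.+1) F i.
  by apply: eq_bigl => i; rewrite finset.in_setT.
rewrite !(finset.set_partition_big _ PP) /=.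
apply: eq_bigr => B PB; rewrite -block_massE.
under eq_bigr => i iB do rewrite /jeffrey_pmf (finset.def_pblock tP PB iB).
rewrite -mulr_sumr -mulr_suml -block_massE divff ?mulr1 //.
have [B0|[i iB]] := finset.set_0Vmem B; first by rewrite -B0 PB in nP.
rewrite block_massE (bigD1 i) //= gt_eqF // ltr_pwDl // sumr_ge0 // => j _.
exact: ltW.
Qed.

(* Main.v *)
(* Write r i = pstar(i)/p(i).  Merging two points i and j into one block turns
   E_pstar[d] > 0 into a nonpositive Jeffrey expectation; the difference of the
   two is a positive multiple of (d i - d j)(r i - r j), so d and r are strictly
   increasing in the same order.  At the minimum i0 of d, also the minimum of r,
   d is nonpositive.  If E_p[d] >= 0, the partition {i0}, X \ {i0} gives a
   positive Jeffrey expectation, as it multiplies the positive part of E_p[d]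
   carried by X \ {i0} by a larger factor than the nonpositive part at i0. *)
Require Import Defs.
From HB Require Import structures.
From mathcomp Require Import all_boot all_order all_algebra.
From mathcomp Require Import all_classical all_reals all_analysis.
From mathcomp Require Import ring lra.

Set Implicit Arguments.
Unset Strict Implicit.
Unset Printing Implicit Defensive.

Import Order.TTheory GRing.Theory Num.Theory.

Local Open Scope classical_set_scope.
Local Open Scope ring_scope.

(** The blocks are the nonempty fibres of [f], and a nonempty fibre determines the value taken on
    it. *)
Lemma card_preim_partition (T U : finType) (f : T -> U) :
  #|finset.preim_partition f (finset.setTfor T)| = #|codom f|.
Proof.
set D := finset.setTfor T.
have eR : {in D & &, equivalence_rel [rel x y | f x == f y]}.
  by split=> //= /eqP->.
pose F y := finset.finset [pred x | f x == y].
have -> : finset.preim_partition f D = F @: codom f.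
  apply/setP => B; apply/imsetP/imsetP => -[x xD ->].
    exists (f x); first exact: codom_f.
    by apply/finset.setP => z; rewrite !finset.inE /= eq_sym.
  case/codomP: xD => z ->; exists z; first by rewrite finset.in_setT.
  by apply/finset.setP => y; rewrite !finset.inE /= eq_sym.
rewrite card_in_imset // => y z /codomP[x ->] _ /finset.setP/(_ x).
by rewrite !finset.inE eqxx => /esym/eqP.
Qed.

(** Partitions are handled through labelling functions. A label outside the image of [f] is
    harmless: its first factor is an empty sum, so the quotient [0 / 0] is multiplied by [0]. *)
Lemma expect_jeffrey_preim (R : realType) (n : nat) (U : finType)
    (f : 'I_n.+1 -> U) (pstar p : probability 'I_n.+1 R) (d : 'I_n.+1 -> R) :
  expect (jeffrey (finset.preim_partition f (finset.setTfor 'I_n.+1)) pstar p) d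
  = \sum_(y : U) (\sum_(i | f i == y) pt_mass pstar i) *
      ((\sum_(i | f i == y) d i * pt_mass p i) /
       (\sum_(i | f i == y) pt_mass p i)).
Proof.
rewrite /expect (partition_big f xpredT) //=; apply: eq_bigr => y _.
rewrite mulrCA mulr_suml; apply: eq_bigr => i /eqP fi.
rewrite pt_mass_jeffrey /jeffrey_pmf !block_massE.
have E k : (k \in finset.pblock
    (finset.preim_partition f (finset.setTfor 'I_n.+1)) i) = (f k == y).
  rewrite finset.pblock_equivalence_partition ?finset.in_setT //=.
    by rewrite fi eq_sym.
  by split=> //= /eqP->.
by rewrite !(eq_bigl _ _ E); ring.
Qed.

Lemma proper_nontrivial_preim (n : nat) (U : finType) (f : 'I_n.+1 -> U) :
  (2 <= #|codom f| <= n)%N ->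
  proper_nontrivial (finset.preim_partition f (finset.setTfor 'I_n.+1)).
Proof.
by move=> fn; rewrite /proper_nontrivial finset.preim_partitionP
  card_preim_partition subn1.
Qed.

(** For two points with prior masses [p], [q], target masses [s], [t] and values [a], [b] of [d],
    this is the drop in expectation when they are merged into one block. *)
Lemma merge_gain (R : realFieldType) (s t p q a b : R) : 0 < p -> 0 < q ->
  s * a + t * b - (s + t) * ((a * p + b * q) / (p + q)) =
  (a - b) * (s * q - t * p) / (p + q).
Proof. by move=> p0 q0; field; rewrite gt_eqF // addr_gt0. Qed.

Lemma comonotone_of_jeffrey (R : realType) (n : nat) (hn : (3 <= n.+1)%N)
  (pstar p : probability 'I_n.+1 R)
  (p_gt0 : forall i : 'I_n.+1, 0 < pt_mass p i) (d : 'I_n.+1 -> R)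
  (Epstar : 0 < expect pstar d)
  (EJeffrey : forall P : {set {set 'I_n.+1}}, proper_nontrivial P ->
     expect (jeffrey P pstar p) d <= 0) (i j : 'I_n.+1) : i != j ->
  0 < (d i - d j) * (pt_mass pstar i * pt_mass p j - pt_mass pstar j * pt_mass p i).
Proof.
(* The fibres of [f] are [{i, j}], the other singletons, and an empty one over [j]. This gives [n]
   blocks, the largest number allowed. *)
move=> ij; pose f k := if k == j then i else k.
have fC : codom f =i predC1 j.
  move=> k; rewrite !inE; apply/codomP/idP => [[l ->]|kj].
    by rewrite /f; case: ifPn.
  by exists k; rewrite /f (negPf kj).
have /EJeffrey : proper_nontrivial
    (finset.preim_partition f (finset.setTfor 'I_n.+1)).
  apply: proper_nontrivial_preim.
  by rewrite (eq_card fC) cardC1 card_ord /= leqnn andbT.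
have fi (F : 'I_n.+1 -> R) : \sum_(k | f k == i) F k = F i + F j.
  rewrite (bigD1 i) /=; last by rewrite /f (negPf ij).
  rewrite (bigD1 j) /=; last by rewrite /f !eqxx eq_sym.
  rewrite big1 ?addr0 // => k; rewrite /f.
  by case: (k == j); rewrite ?andbF // andbT => /andP[/eqP->]; rewrite eqxx.
have fj (F : 'I_n.+1 -> R) : \sum_(k | f k == j) F k = 0.
  rewrite big_pred0 // => k; rewrite /f.
  by have [_|/negPf//] := eqVneq k j; exact: negPf.
have fk (F : 'I_n.+1 -> R) k : k != i -> k != j -> \sum_(l | f l == k) F l = F k.
  move=> ki kj; rewrite (big_pred1 k) // => l; rewrite /f /=.
  have [->|//] := eqVneq l j.
  by rewrite eq_sym (negPf ki) eq_sym (negPf kj).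
rewrite expect_jeffrey_preim (bigD1 i) //= !fi (bigD1 j) /=; last by rewrite eq_sym.
rewrite !fj !mul0r add0r.
move: Epstar; rewrite /expect (bigD1 i) //= (bigD1 j) /=; last by rewrite eq_sym.
(* A singleton block contributes the same to both expectations, so these terms cancel in the
   difference. *)
under [X in _ -> _ + X <= 0 -> _]eq_bigr => k /andP[ki kj].
  rewrite !fk // mulfK ?gt_eqF // mulrC; over.
move=> H1 H2; have pq : 0 < pt_mass p i + pt_mass p j by rewrite addr_gt0.
have pqV : 0 < (pt_mass p i + pt_mass p j)^-1 by rewrite invr_gt0.
rewrite -(pmulr_lgt0 _ pqV).
rewrite -merge_gain //; lra.
Qed.

Theorem theorem2p4 (R : realType) (n : nat) (hn : (3 <= n.+1)%N)
  (pstar p : probability 'I_n.+1 R)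
  (p_gt0 : forall i : 'I_n.+1, 0 < pt_mass p i)
  (f1 f2 : 'I_n.+1 -> R) (d : 'I_n.+1 -> R)
  (dE : d = (fun i => f1 i - f2 i))
  (d_not_pos : ~ (forall i : 'I_n.+1, 0 < d i))
  (Epstar : 0 < expect pstar d)
  (EJeffrey : forall P : {set {set 'I_n.+1}}, proper_nontrivial P ->
     expect (jeffrey P pstar p) d <= 0) :
  expect p d < 0.
Proof.
rewrite ltNge; apply/negP => Ep.
have como := comonotone_of_jeffrey hn p_gt0 Epstar EJeffrey.
have [i0 _ i0min] := @Order.TotalTheory.arg_minP _ R _ ord0 xpredT d isT.
have di0 : d i0 <= 0.
  rewrite leNgt; apply/negP => di0; apply: d_not_pos => i.
  exact: lt_le_trans (i0min i isT).
(* A tie would make the product in [como] vanish, so the minimiser is unique. *)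
have lt_d i : i != i0 -> d i0 < d i.
  move=> ii0; rewrite lt_neqAle i0min // andbT; apply/eqP => e.
  by have := como _ _ ii0; rewrite e subrr mul0r ltxx.
have lt_r i : i != i0 ->
    pt_mass pstar i0 * pt_mass p i < pt_mass pstar i * pt_mass p i0.
  move=> ii0; rewrite -subr_gt0 -(pmulr_rgt0 _ (x := d i - d i0)) ?como //.
  by rewrite subr_gt0 lt_d.
have [i1 i1i0] : exists i1, i1 != i0.
  have : (0 < #|predC1 i0|)%N by rewrite cardC1 card_ord -ltnS ltnW.
  by case/card_gt0P => i1; exists i1.
have sum_gt (F G : 'I_n.+1 -> R) : (forall i, i != i0 -> F i < G i) ->
    \sum_(i | i != i0) F i < \sum_(i | i != i0) G i.
  move=> FG; apply: ltr_sum => [|i]; last exact: FG.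
  by apply/hasP; exists i1; rewrite ?mem_index_enum.
have sum_gt0 (F : 'I_n.+1 -> R) : (forall i, i != i0 -> 0 < F i) ->
    0 < \sum_(i | i != i0) F i.
  by move=> F0; have := sum_gt (fun=> 0) F F0; rewrite big1_eq.
have /EJeffrey : proper_nontrivial (finset.preim_partition
    (fun i => i == i0) (finset.setTfor 'I_n.+1)).
  apply: proper_nontrivial_preim.
  have /eq_card-> : codom (fun i => i == i0) =i predT.
    case; rewrite inE; apply/codomP; first by exists i0; rewrite eqxx.
    by exists i1; rewrite (negPf i1i0).
  by rewrite card_bool.
rewrite expect_jeffrey_preim big_bool /=.
have T (F : 'I_n.+1 -> R) : \sum_(i | (i == i0) == true) F i = F i0.
  by rewrite (big_pred1 i0) // => i; rewrite eqb_id.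
have N (F : 'I_n.+1 -> R) :
    \sum_(i | (i == i0) == false) F i = \sum_(i | i != i0) F i.
  by apply: eq_bigl => i; rewrite eqbF_neg.
rewrite !T !N mulfK ?gt_eqF //.
move: Ep; rewrite /expect (bigD1 i0) //=.
have q_gt0 : 0 < \sum_(i | i != i0) pt_mass p i.
  exact: sum_gt0.
have := sum_gt _ _ lt_r; rewrite -mulr_sumr -mulr_suml.
(* When [d i0 = 0], the bound [0 <= expect p d] yields only [0 <= D]; strictness then comes from
   [lt_d]. *)
have D_gt : d i0 * pt_mass p i0 = 0 -> 0 < \sum_(i | i != i0) d i * pt_mass p i.
  move/eqP; rewrite mulf_eq0 (gt_eqF (p_gt0 i0)) orbF => /eqP d0.
  by apply: sum_gt0 => i /lt_d; rewrite d0 => di; exact: mulr_gt0.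
move: D_gt q_gt0.
set q := \sum_(i | i != i0) pt_mass p i.
set t := \sum_(i | i != i0) pt_mass pstar i.
set D := \sum_(i | i != i0) d i * pt_mass p i.
move=> D_gt q_gt0 lt_st Ep; apply/negP; rewrite -ltNge.
have D_gt0 : 0 < D.
  have : d i0 * pt_mass p i0 <= 0 by rewrite pmulr_lle0.
  rewrite le_eqVlt => /orP[/eqP/D_gt//|]; lra.
have p0 := p_gt0 i0.
have s_ge0 : 0 <= pt_mass pstar i0 by rewrite fine_ge0.
(* After clearing denominators, the expectation splits into a term positive by [D_gt0] and [lt_st]
   and a term nonnegative by [Ep]. *)
rewrite -(pmulr_lgt0 _ (mulr_gt0 q_gt0 p0)).
have -> : (pt_mass pstar i0 * d i0 + t * (D / q)) * (q * pt_mass p i0) =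
    D * (t * pt_mass p i0 - pt_mass pstar i0 * q) +
    pt_mass pstar i0 * q * (d i0 * pt_mass p i0 + D).
  by field; rewrite gt_eqF.
by rewrite ltr_wpDr ?mulr_ge0 ?mulr_gt0 ?subr_gt0 // ltW.
Qed.
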